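(* Let $g_i:\mathbb{R}\to\mathbb{R}$ be convex functions for $i\in[n]$, let $m\in\mathbb{R}^n$ and $r,q\in\mathbb{R}$. Let $a_1,\dots,a_n\in\mathbb{R}^n$ be such that $a_n\ne0$ and $a_i\perp a_j$ for all $i\ne j$, and let $\alpha_1,\dots,\alpha_n\in\mathbb{R}_+$ be such that $\alpha_n\ne0$ and $\alpha_n\ge\alpha_i$ for all $i$. Let $$G(x)=\sum_{i=1}^ng_i(a_i^Tx)+m^Tx+r,\qquad J(x)=-\sum_{i=1}^n\alpha_ig_i(a_i^Tx)-\alpha_nm^Tx-q,$$ $B=\{x\in\mathbb{R}^n:G(x)\le0\}$, and $F=\{x\in\mathbb{R}^n:J(x)\ge0\}$. If $$\lim_{|s|\to\infty}\;-\alpha_ng_n(s\,a_n^Ta_n)-s\,\alpha_nm^Ta_n=-\infty,$$ then $$\mathrm{conv}\bigl(B\setminus \mathrm{int}(F)\bigr)=\mathrm{conv}\bigl(\{x\in\mathbb{R}^n:G(x)\le0,\ J(x)\le0\}\bigr)=\{x\in\mathbb{R}^n:G(x)\le0,\ W(x)\le0\},$$ where $$W(x)=G(x)+(1/\alpha_n)J(x)=\sum_{i=1}^{n-1}(1-\alpha_i/\alpha_n)g_i(a_i^Tx)+(r-q/\alpha_n).$$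
   Context: $[n]=\{1,\dots,n\}$ and $\mathbb{R}_+$ is the set of nonnegative reals. $\mathrm{int}$ is the topological interior and $\mathrm{conv}$ the convex hull. *)

(* Defs.v *)
From HB Require Import structures.
From mathcomp Require Import all_boot all_order all_algebra.
From mathcomp Require Import all_classical all_reals all_analysis.

Set Implicit Arguments.
Unset Strict Implicit.
Unset Printing Implicit Defensive.

Import Order.TTheory GRing.Theory Num.Theory.
Import numFieldNormedType.Exports.

Local Open Scope classical_set_scope.
Local Open Scope ring_scope.

Definition dot (R : realType) (n : nat) (u v : 'cV[R]_n) : R :=
  (u^T *m v) ord0 ord0.

Definition convex_hull (R : realType) (n : nat) (A : set 'cV[R]_n) :
  set 'cV[R]_n := smallest (@convex_set R 'cV[R]_n) A.

(* The filter of the limits "|s| -> oo" over the reals, covering both ends of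
   the line at once; its base is given by the sets {s | K < |s|}. *)
Definition abs_infty (R : realType) : set_system R :=
  filter_from [set: R] (fun K => [set s | K < `|s|]).

#[global] Instance abs_infty_proper (R : realType) :
  ProperFilter (@abs_infty R).
Proof.
apply: filter_from_proper; last first.
  move=> K _; exists (`|K| + 1) => /=.
  by rewrite ger0_norm ?addr_ge0// (le_lt_trans (ler_norm K))// ltrDl.
apply: filter_from_filter; first by exists 0.
move=> K L _ _; exists (Num.max K L) => // s /=.
by rewrite gt_max => /andP[].
Qed.

(* Main.v *)
(* Orthogonality makes W invariant along the line x + t a_n, while J
   tends to -oo at both ends of it.  If G x <= 0, W x <= 0 and
   x lies in the interior of F, then in each direction the line has a last
   point at which J >= 0; that point is not interior to F, and there
   G = W - J / alpha_n <= W <= 0.  So x is between two points of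
   B \ int F, whence {G <= 0, W <= 0} is contained in conv (B \ int F).
   The reverse inclusions hold because J <= 0 outside int F (J is continuous),
   W <= G wherever J <= 0, and G and W are convex. *)
Require Import Defs.
From HB Require Import structures.
From mathcomp Require Import all_boot all_order all_algebra.
From mathcomp Require Import all_classical all_reals all_analysis.
From mathcomp Require Import ring lra.
Import Order.TTheory GRing.Theory Num.Theory.
Import numFieldNormedType.Exports.
Local Open Scope classical_set_scope.
Local Open Scope ring_scope.

(** * Continuity of pointwise sums and differences *)

Lemma continuous_sum {R : numFieldType} {T : topologicalType} (I : Type)
    (s : seq I) (f : I -> T -> R) :
  (forall i, continuous (f i)) -> continuous (fun x => \sum_(i <- s) f i x).
Proof.
by move=> cf; apply: (continuous_big (@add_continuous R^o)) => i _; exact: cf.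
Qed.

(* [continuousB] is about the difference [f - g] in the ring of functions, which
   does not unify with a pointwise one. *)
Lemma continuous_sub {R : numFieldType} {T : topologicalType} (f g : T -> R) :
  continuous f -> continuous g -> continuous (fun x => f x - g x).
Proof. by move=> cf cg x; apply: (@continuousB R R^o); [exact: cf|exact: cg]. Qed.

Section dot.
Context {R : realType} {n : nat}.
Implicit Types u v : 'cV[R]_n.

Lemma dot_is_linear u : linear (dot u : 'cV[R]_n -> R^o).
Proof. by move=> k x y; rewrite /dot mulmxDr -scalemxAr !mxE. Qed.

(** Registering linearity lets [linearD], [linearZ] and [convex_function_comp_linear] apply to
    [dot u]. *)
HB.instance Definition _ u :=
  GRing.isLinear.Build R 'cV[R]_n R^o *:%R (dot u) (dot_is_linear u).

Lemma dotDZ u x y k : dot u (x + k *: y) = dot u x + k * dot u y.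
Proof. by rewrite addrC [in RHS]addrC; exact: dot_is_linear. Qed.

Lemma dot_gt0 u : u != 0 -> 0 < dot u u.
Proof.
move=> u0; rewrite /dot mxE lt_neqAle; apply/andP; split; last first.
  by apply: sumr_ge0 => i _; rewrite mxE -expr2 sqr_ge0.
apply: contra u0; rewrite eq_sym psumr_eq0 => [/allP u0|i _]; last first.
  by rewrite mxE -expr2 sqr_ge0.
apply/eqP/matrixP => i j; rewrite ord1 [in RHS]mxE; apply/eqP.
have := u0 i (mem_index_enum i).
by rewrite mxE mulf_eq0 orbb.
Qed.

Lemma dot_continuous u : continuous (dot u).
Proof.
rewrite [dot u](_ : _ = fun y : 'cV[R]_n => \sum_i u i ord0 * y i ord0).
  apply: continuous_sum => i x; apply: (@continuousM R).
    exact: cst_continuous.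
  exact: (@coord_continuous R).
by apply/funext => y; rewrite /dot mxE; apply: eq_bigr => i _; rewrite mxE.
Qed.

End dot.

(** * Closure properties of convex functions and convex sets *)

Section convex_functions.
Context {R : numFieldType} {E : lmodType R}.
Implicit Types f g : E -> R.

Lemma convex_function_cst (c : R) : convex_function [set: E] (fun=> c).
Proof. by move=> t x y _ _; rewrite convmm. Qed.

Lemma convex_functionD f g : convex_function [set: E] f ->
  convex_function [set: E] g -> convex_function [set: E] (fun x => f x + g x).
Proof.
move=> cf cg t x y xT yT.
apply: le_trans (lerD (cf t x y xT yT) (cg t x y xT yT)) _.
by rewrite !convRE !mulrDr addrACA.
Qed.

Lemma convex_functionZ (c : R) f : 0 <= c -> convex_function [set: E] f ->
  convex_function [set: E] (fun x => c * f x).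
Proof.
move=> c0 cf t x y xT yT; apply: le_trans (ler_wpM2l c0 (cf t x y xT yT)) _.
by rewrite !convRE mulrDr !(mulrCA c).
Qed.

Lemma convex_function_sum (I : Type) (s : seq I) (f : I -> E -> R) :
  (forall i, convex_function [set: E] (f i)) ->
  convex_function [set: E] (fun x => \sum_(i <- s) f i x).
Proof.
move=> cf; elim: s => [|i s IHs].
  rewrite (_ : (fun _ => _) = fun=> 0); first exact: convex_function_cst.
  by apply/funext => x; rewrite big_nil.
rewrite (_ : (fun _ => _) = fun x => f i x + \sum_(i <- s) f i x).
  exact: convex_functionD.
by apply/funext => x; rewrite big_cons.
Qed.

Lemma convex_function_comp_linear (h : R -> R) (l : {linear E -> R^o}) :
  convex_function [set: R^o] h -> convex_function [set: E] (h \o l).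
Proof.
move=> ch t x y _ _ /=.
have -> : l (conv t x y) = conv t (l x : R^o) (l y) by rewrite linearD !linearZ.
exact: (ch t (l x) (l y) (in_setT _) (in_setT _)).
Qed.

Lemma convex_set_sublevel f (c : R) : convex_function [set: E] f ->
  convex_set [set x : E | f x <= c].
Proof.
move=> cf x y t; rewrite !inE /= => fx fy.
apply: le_trans (cf t x y (in_setT _) (in_setT _)) _; rewrite convRE.
(* The bound [c] is written as the combination of [c] with itself, so that the two sides compare
   term by term. *)
rewrite -[leRHS](@convmm R R^o t) convRE.
by apply: lerD; apply: ler_wpM2l; rewrite ?subr_ge0 ?ge0 ?le1.
Qed.

End convex_functions.

Lemma convex_setI {R : numDomainType} {E : lmodType R}
    (A B : set (convex_lmodType E)) :
  convex_set A -> convex_set B -> convex_set (A `&` B).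
Proof.
move=> cA cB x y t; rewrite !in_setI => /andP[xA xB] /andP[yA yB].
by rewrite cA ?cB.
Qed.

(** * Continuity of convex functions, and exit points along a ray *)

Section continuity.
Context {R : realType}.

(* The upper bound uses that x + s d is between x and x + d, the lower bound
   that x is between x - d and x + s d. *)
Lemma convex_function_local_lipschitz (f : R -> R) (x d s M : R) :
  convex_function [set: R^o] f ->
  f (x + d) - f x <= M -> f (x - d) - f x <= M -> 0 <= s -> s <= 1 ->
  `|f x - f (x + s * d)| <= s * M.
Proof.
move=> cf Mp Mm s0 s1.
have s10 : 0 < 1 + s by lra.
have i0 : 0 <= s / (1 + s) by rewrite divr_ge0 // ltW.
have i1 : s / (1 + s) <= 1 by rewrite ler_pdivrMr// mul1r; lra.
have := cf (Itv01 s0 s1) (x + d) x (in_setT _) (in_setT _).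
have := cf (Itv01 i0 i1) (x - d) (x + s * d) (in_setT _) (in_setT _).
rewrite !convRE /conv /= /unstable.onem /GRing.scale /=.
have -> : s / (1 + s) * (x - d) + (1 - s / (1 + s)) * (x + s * d) = x.
  by field; rewrite gt_eqF.
have -> : s * (x + d) + (1 - s) * x = x + s * d by ring.
have -> : s / (1 + s) * f (x - d) + (1 - s / (1 + s)) * f (x + s * d) =
   (s * f (x - d) + f (x + s * d)) / (1 + s) by field; rewrite gt_eqF.
(* [lo] now reads (1 + s) f x <= s f (x - d) + f (x + s d), that is, f x - f (x + s d) <= s (f (x -
   d) - f x). *)
rewrite ler_pdivlMr// => lo up.
by rewrite ler_norml; apply/andP; split; nra.
Qed.

Lemma convex_function_continuous (f : R -> R) :
  convex_function [set: R^o] f -> continuous f.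
Proof.
move=> cf x; apply/cvgrPdist_le => e e0.
(* [M] dominates both increments of [f] at unit distance from [x]; the final 1 makes it positive, so
   that one can divide by it. *)
pose M := `|f (x + 1) - f x| + `|f (x - 1) - f x| + 1.
have M0 : 0 < M by rewrite ltr_wpDl// addr_ge0.
have Mp : f (x + 1) - f x <= M.
  by apply: le_trans (ler_norm _) _; rewrite /M -addrA lerDl addr_ge0.
have Mm : f (x - 1) - f x <= M.
  by apply: le_trans (ler_norm _) _; rewrite /M addrAC lerDr addr_ge0.
near=> y.
have y1 : `|x - y| <= 1.
  by near: y; apply: (@cvgrPdist_le _ _ _ _ _ id x).1 => //; exact: cvg_id.
have yM : `|x - y| <= e / M.
  near: y; apply: (@cvgrPdist_le _ _ _ _ _ id x).1; first exact: cvg_id.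
  exact: divr_gt0.
apply: (@le_trans _ _ (`|x - y| * M)); last by rewrite -ler_pdivlMr.
(* The Lipschitz bound is used with step s = |x - y| and d = 1 or d = -1, according to the side of
   [x] on which [y] lies. *)
have [xy|yx] := leP x y.
  have {1}-> : y = x + `|x - y| * 1 by rewrite distrC ger0_norm; lra.
  exact: convex_function_local_lipschitz.
have {1}-> : y = x + `|x - y| * -1 by rewrite gtr0_norm; lra.
by apply: convex_function_local_lipschitz => //; rewrite opprK.
Unshelve. all: by end_near. Qed.

Lemma gt0_interior (T : topologicalType) (f : T -> R) (x : T) :
  continuous f -> 0 < f x -> [set y | 0 <= f y]° x.
Proof. by move=> cf; exact: (cvgr_ge _ (cf x)). Qed.

(** The parameter is the supremum of the [t >= 0] with J (x + t v) >= 0: this set is nonempty,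
    bounded by [K], and closed because [J] is continuous. *)
Lemma ray_exit (V : normedModType R) (J : V -> R) (x v : V) (K : R) :
  continuous J -> 0 <= J x -> (forall t, K < t -> J (x + t *: v) < 0) ->
  exists t, [/\ 0 <= t, 0 <= J (x + t *: v) &
    ~ [set y | 0 <= J y]° (x + t *: v)].
Proof.
move=> cJ Jx JK.
pose A := [set t : R | 0 <= t] `&` [set t | 0 <= J (x + t *: v)].
have cp : continuous (fun t : R => x + t *: v).
  by move=> t; apply: cvgD; [exact: cvg_cst|apply: cvgZl; exact: cvg_id].
have A0 : A 0 by split => //=; rewrite scale0r addr0.
have ubA : has_ubound A.
  by exists K => t [_ /= Jt]; rewrite leNgt; apply/negP => /JK; rewrite ltNge Jt.
have clA : closed A.
  apply: closedI; first exact: closed_ge.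
  apply: (@preimage_closed R R (fun t => J (x + t *: v)) [set y | 0 <= y]).
    by move=> t _; apply: (continuous_comp (cp t)); exact: cJ.
  exact: closed_ge.
have [s0 Js] : A (sup A) by apply: clA; apply: closure_sup => //; exists 0.
exists (sup A); split => // /cp /= /nbhs_ballP [e /= e0 He].
(* Were the exit point interior, parameters within some [e] of the supremum would keep [J]
   nonnegative, including one beyond it. *)
have : A (sup A + e / 2).
  split => /=; first by rewrite addr_ge0// divr_ge0// ltW.
  apply: He; rewrite /ball/= opprD addNKr normrN gtr0_norm; lra.
by move/(ub_le_sup ubA); lra.
Qed.

End continuity.

(** * Convex hulls *)

Section hull.
Context {R : realType} {n : nat}.
Implicit Types A : set 'cV[R]_n.

Lemma convex_hull_convex A : convex_set (convex_hull A).
Proof.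
move=> x y t; rewrite !inE => xA yA D [cD AD].
by apply/set_mem/cD; apply/mem_set; [exact: xA|exact: yA].
Qed.

Lemma sub_convex_hull A : A `<=` convex_hull A.
Proof. exact: sub_gen_smallest. Qed.

(** The point [x] is the combination of x + t v and x - u v with weights u / (t + u) and t / (t +
    u); when t + u = 0 the first point is already [x]. *)
Lemma convex_hull_segment A (x v : 'cV[R]_n) (t u : R) : 0 <= t -> 0 <= u ->
  convex_hull A (x + t *: v) -> convex_hull A (x - u *: v) -> convex_hull A x.
Proof.
move=> t0 u0 At Au; have [tu0|tu0] := eqVneq (t + u) 0.
  have t00 : t = 0 by lra.
  by move: At; rewrite t00 scale0r addr0.
have tu : 0 < t + u by rewrite lt_neqAle eq_sym tu0 addr_ge0.
have l0 : 0 <= u / (t + u) by rewrite divr_ge0 ?addr_ge0.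
have l1 : u / (t + u) <= 1 by rewrite ler_pdivrMr// mul1r lerDr.
have := convex_hull_convex A _ _ (Itv01 l0 l1) (mem_set At) (mem_set Au).
rewrite inE; congr (convex_hull A _).
rewrite /conv /= /unstable.onem !scalerDr scalerN !scalerA addrACA -scalerDl.
rewrite subrKC scale1r -scalerBl.
rewrite (_ : _ - _ = 0) ?scale0r ?addr0//.
by field.
Qed.

End hull.

(** The bound [K] controls both ends of the line, so [ray_exit] applies to [v] and to [- v], and [x]
    lies between the two exit points. *)
Lemma convex_hull_setD_interior (R : realType) (n : nat) (C : set 'cV[R]_n.+1)
    (J : 'cV[R]_n.+1 -> R) (x v : 'cV[R]_n.+1) (K : R) :
  continuous J -> C x -> (forall t, 0 <= J (x + t *: v) -> C (x + t *: v)) ->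
  (forall t, K < `|t| -> J (x + t *: v) < 0) ->
  convex_hull (C `\` [set y | 0 <= J y]°) x.
Proof.
move=> cJ Cx CJ JK.
have [/interior_subset /= Jx|Fx] := pselect ([set y | 0 <= J y]° x); last first.
  exact: sub_convex_hull.
have JKp t : K < t -> J (x + t *: v) < 0.
  by move=> Kt; apply: JK; apply: lt_le_trans Kt (ler_norm t).
have JKn t : K < t -> J (x + t *: - v) < 0.
  move=> Kt; rewrite scalerN -scaleNr; apply: JK.
  by rewrite normrN; apply: lt_le_trans Kt (ler_norm t).
have [t [t0 Jt Ft]] := ray_exit _ _ _ _ _ cJ Jx JKp.
have [u [u0 Ju Fu]] := ray_exit _ _ _ _ _ cJ Jx JKn.
rewrite scalerN in Ju Fu.
apply: (convex_hull_segment _ _ v t u t0 u0); apply: sub_convex_hull; split=> //.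
  exact: CJ.
by rewrite -scaleNr; apply: CJ; rewrite scaleNr.
Qed.

(* The dimension is n.+1, and the distinguished last index is ord_max. *)
Theorem proposition5p2 (R : realType) (n : nat)
    (g : 'I_n.+1 -> R -> R) (m : 'cV[R]_n.+1) (r q : R)
    (a : 'I_n.+1 -> 'cV[R]_n.+1) (alpha : 'I_n.+1 -> R) :
  (forall i, convex_function [set: R^o] (g i)) ->
  a ord_max != 0 ->
  (forall i j, i != j -> dot (a i) (a j) = 0) ->
  (forall i, 0 <= alpha i) ->
  alpha ord_max != 0 ->
  (forall i, alpha i <= alpha ord_max) ->
  let G := fun x : 'cV[R]_n.+1 =>
    \sum_(i < n.+1) g i (dot (a i) x) + dot m x + r in
  let J := fun x : 'cV[R]_n.+1 =>
    - (\sum_(i < n.+1) alpha i * g i (dot (a i) x))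
    - alpha ord_max * dot m x - q in
  let B := [set x : 'cV[R]_n.+1 | G x <= 0] in
  let F := [set x : 'cV[R]_n.+1 | 0 <= J x] in
  let W := fun x : 'cV[R]_n.+1 => G x + 1 / alpha ord_max * J x in
  (- (alpha ord_max * g ord_max (s * dot (a ord_max) (a ord_max)))
    - s * (alpha ord_max * dot m (a ord_max))) @[s --> @abs_infty R] --> -oo ->
  [/\ convex_hull (B `\` F°) =
        convex_hull [set x : 'cV[R]_n.+1 | G x <= 0 /\ J x <= 0],
      convex_hull [set x : 'cV[R]_n.+1 | G x <= 0 /\ J x <= 0] =
        [set x : 'cV[R]_n.+1 | G x <= 0 /\ W x <= 0]
    & forall x : 'cV[R]_n.+1,
        W x = \sum_(i < n)
                (1 - alpha (widen_ord (leqnSn n) i) / alpha ord_max)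
                  * g (widen_ord (leqnSn n) i)
                      (dot (a (widen_ord (leqnSn n) i)) x)
              + (r - q / alpha ord_max)].
Proof.
set p := ord_max; set w := widen_ord _.
move=> cg an0 orth alpha0 alphan0 alphan G J B F W lim.
have ap0 : 0 < alpha p by rewrite lt_neqAle eq_sym alphan0 alpha0.
(* The term of index [p] has coefficient 1 - alpha_p / alpha_p = 0, and the two terms in [m]
   cancel. *)
have WE x : W x = \sum_(i < n) (1 - alpha (w i) / alpha p)
    * g (w i) (dot (a (w i)) x) + (r - q / alpha p).
  rewrite /W /G /J !big_ord_recr /= -/p -/w.
  under [in RHS]eq_bigr do rewrite mulrBl mul1r mulrAC.
  rewrite sumrB -mulr_suml.
  by field.
have wp i : w i != p by rewrite -val_eqE /= neq_ltn ltn_ord.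
have dot_line i x t : dot (a (w i)) (x + t *: a p) = dot (a (w i)) x.
  by rewrite dotDZ orth ?mulr0 ?addr0.
have W_line x t : W (x + t *: a p) = W x.
  by rewrite !WE; congr (_ + _); apply: eq_bigr => i _; rewrite dot_line.
have GWJ x : G x = W x - J x / alpha p by rewrite /W; ring.
have cJ : continuous J.
  apply: continuous_sub; last by move=> x; exact: cst_continuous.
  apply: continuous_sub => x.
    apply: (@continuousN R R^o); apply: continuous_sum => i y.
    apply: (@continuousM R); first exact: cst_continuous.
    apply: (continuous_comp (dot_continuous (a i) y)).
    exact: convex_function_continuous.
  apply: (@continuousM R); first exact: cst_continuous.
  exact: dot_continuous.
have linE (u : 'cV[R]_n.+1) : convex_function [set: 'cV[R]_n.+1] (dot u).
  by move=> t x y _ _; rewrite linearD !linearZ.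
have cvxG : convex_function [set: 'cV[R]_n.+1] G.
  apply: convex_functionD; last exact: convex_function_cst.
  apply: convex_functionD => //; apply: convex_function_sum => i.
  exact: (convex_function_comp_linear (g i) (dot (a i))).
have cvxW : convex_function [set: 'cV[R]_n.+1] W.
  (* Convexity is read off the reduced form of [W], whose coefficients are nonnegative because
     alpha_i <= alpha_p. *)
  rewrite (funext WE); apply: convex_functionD; last exact: convex_function_cst.
  apply: convex_function_sum => i; apply: convex_functionZ.
    by rewrite subr_ge0 ler_pdivrMr// mul1r.
  exact: (convex_function_comp_linear (g (w i)) (dot (a (w i)))).
have J_line x : exists K, forall t, K < `|t| -> J (x + t *: a p) < 0.
  have d0 := dot_gt0 _ an0; have d0' : dot (a p) (a p) != 0 by rewrite gt_eqF.
  (* [c] is the coordinate of [x] along [a p], so s = t + c turns the argument of [g p] into that of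
     the limit hypothesis. [C] collects what stays constant on the line: J (x + t a_p) is the
     expression of the hypothesis at s, plus [C]. *)
  pose c := dot (a p) x / dot (a p) (a p).
  pose C := - (\sum_(i < n) alpha (w i) * g (w i) (dot (a (w i)) x))
    - alpha p * dot m x + c * (alpha p * dot m (a p)) - q.
  have [K _ HK] := (cvgrNyPlt _).1 lim (- C).
  (* The extra |c| absorbs the shift from t to t + c. *)
  exists (K + `|c|) => t Kt.
  have /HK /= : K < `|t + c|.
    by have := ler_normB (t + c) c; rewrite addrK; lra.
  have -> : (t + c) * dot (a p) (a p) = dot (a p) (x + t *: a p).
    by rewrite dotDZ /c; field.
  rewrite /J big_ord_recr /= -/p -/w [dot m (x + _)]dotDZ.
  under eq_bigr do rewrite dot_line.
  by rewrite /C; lra.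
have sub1 : B `\` F° `<=` [set x | G x <= 0 /\ J x <= 0].
  move=> x [Bx Fx]; split=> //; rewrite leNgt; apply/negP => Jx; apply: Fx.
  exact: gt0_interior.
have sub2 : convex_hull [set x | G x <= 0 /\ J x <= 0] `<=`
    [set x | G x <= 0 /\ W x <= 0].
  apply: smallest_sub.
    by apply: convex_setI; exact: convex_set_sublevel.
  move=> x [Gx Jx]; split=> //; rewrite /W.
  by have := mulr_ge0_le0 (ltW (divr_gt0 ltr01 ap0)) Jx; lra.
have sub3 : [set x | G x <= 0 /\ W x <= 0] `<=` convex_hull (B `\` F°).
  move=> x [Gx Wx]; have [K JK] := J_line x.
  apply: (convex_hull_setD_interior _ _ _ _ _ _ K cJ _ _ JK) => //= t Jt.
  rewrite /B /= GWJ W_line.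
  by have := divr_ge0 Jt (ltW ap0); lra.
have sub12 : convex_hull (B `\` F°) `<=`
    convex_hull [set x | G x <= 0 /\ J x <= 0].
  by apply: sub_smallest2r sub1; exact: convex_hull_convex.
(* [sub12], [sub2] and [sub3] form a cycle of inclusions through the three sets, so all three are
   equal. *)
split=> //; apply/seteqP; split=> //.
  by apply: subset_trans sub2 sub3.
by apply: subset_trans sub3 sub12.
Qed.
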